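(* There exist a positive integer $n$, a polynomial vector field $f:\mathbb{R}^n\to\mathbb{R}^n$, and a polynomial $V:\mathbb{R}^n\to\mathbb{R}$ such that $V$ and $-\dot V=-\langle\nabla V(x),f(x)\rangle$ are positive definite, $-\dot V$ is a sum of squares, but $V$ is not a sum of squares.
   Context: All vector fields $f$ are polynomial with $f(0)=0$. A function $V:\mathbb{R}^n\to\mathbb{R}$ is positive definite if $V(x)>0$ for all $x\neq 0$. A polynomial is a sum of squares (sos) if it equals $\sum_i q_i^2$ for finitely many real polynomials $q_i$. $\dot V(x)=\langle\nabla V(x),f(x)\rangle$ is the derivative of $V$ along trajectories of $\dot x=f(x)$. *)

(* Defs.v *)
From mathcomp Require Import all_boot all_order all_algebra.
From mathcomp Require Import reals.
From mathcomp Require Import mpoly.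

Set Implicit Arguments.
Unset Strict Implicit.
Unset Printing Implicit Defensive.

Import GRing.Theory Num.Theory.
Local Open Scope ring_scope.

Definition polyfun (R : realType) (n : nat) (p : {mpoly R[n]}) :
    'rV[R]_n -> R :=
  fun x => p.@[fun i => x 0 i].

(* No condition is imposed on the value at the origin. *)
Definition positive_definite (R : realType) (n : nat) (g : 'rV[R]_n -> R) :
    Prop :=
  forall x : 'rV[R]_n, x != 0 -> 0 < g x.

Definition sos (R : realType) (n : nat) (p : {mpoly R[n]}) : Prop :=
  exists s : seq {mpoly R[n]}, p = \sum_(q <- s) q ^+ 2.

Definition polynomial_vector_field (R : realType) (n : nat) : Type :=
  'I_n -> {mpoly R[n]}.

Definition vanishes_at_origin (R : realType) (n : nat)
    (f : polynomial_vector_field R n) : Prop :=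
  forall i : 'I_n, polyfun (f i) 0 = 0.

(* <grad V, f>, as a polynomial; V^`M(i) is the i-th partial derivative. *)
Definition Vdot (R : realType) (n : nat) (V : {mpoly R[n]})
    (f : polynomial_vector_field R n) : {mpoly R[n]} :=
  \sum_(i < n) V^`M(i) * f i.

(* Main.v *)
Require Import Defs.
From mathcomp Require Import all_boot all_order all_algebra.
From mathcomp Require Import reals.
From mathcomp Require Import mpoly.
From mathcomp Require Import zify lra.

Set Implicit Arguments.
Unset Strict Implicit.
Unset Printing Implicit Defensive.

Import Order.TTheory GRing.Theory Num.Theory.
Local Open Scope ring_scope.

(** The example is the polynomial
      V = x^4 + y^6 + z^10 + t^60 - x y^2 z^4 t,
    which is homogeneous of degree 60 when x, y, z, t are given the weights
    15, 10, 6, 1, and the vector field is the gradient flow f = - grad V.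

    Along this flow - Vdot = |grad V|^2, which is visibly a sum of squares.  It
    is positive away from 0 because of Euler's identity for the weights,
      15 x V_x + 10 y V_y + 6 z V_z + t V_t = 60 V:
    a critical point of V would be a zero of V ([neg_Vdot_gradient_flow_pd]).

    Positivity of V is weighted arithmetic-geometric mean: the 60th power of
    the mixed term T is (x^4)^15 (y^6)^20 (z^10)^24 (t^60)^1, so T is less than
    the sum of the four pure powers ([mixed_lt_pure_powers]).

    V is not a sum of squares for a combinatorial reason, already present in
    Motzkin's polynomial.  If V = sum_q q^2, no monomial of weight less than 30
    can occur in any q: the square of the smallest such monomial could not
    cancel in the sum ([sos_low_weight]).  Hence the coefficient of the mixed
    monomial in q^2 only collects products of two monomials of weight 30 each.
    But (1,2,4,1) is not the sum of two exponents of weight 30, since x has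
    weight 15 and the complementary 15 cannot be made from some of
    10, 10, 6, 6, 6, 6, 1.  So that coefficient would be 0 instead of -1.
    In geometric terms, the ample degree-30 line bundle on the weighted
    projective space P(15,10,6,1) is not projectively normal. *)

(** * Weighted homogeneous polynomials *)

Definition weight n (w : 'I_n -> nat) (m : 'X_{1..n}) : nat :=
  (\sum_i w i * m i)%N.

Definition weighted_homogeneous (R : nzRingType) n (w : 'I_n -> nat) d
    (p : {mpoly R[n]}) :=
  {in msupp p, forall m, weight w m = d}.

Lemma weightD n (w : 'I_n -> nat) (m1 m2 : 'X_{1..n}) :
  weight w (m1 + m2)%MM = (weight w m1 + weight w m2)%N.
Proof.
by rewrite /weight -big_split; apply: eq_bigr => i _; rewrite mnmDE mulnDr.
Qed.

Lemma weightU n (w : 'I_n -> nat) i : weight w U_(i)%MM = w i.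
Proof.
rewrite /weight (bigD1 i) //= big1 ?addn0; first by rewrite mnm1E eqxx muln1.
by move=> j /negPf ji; rewrite mnm1E eq_sym ji muln0.
Qed.

(** Euler's identity, which holds monomial by monomial. *)
Lemma weighted_euler (R : comNzRingType) n (w : 'I_n -> nat) d (p : {mpoly R[n]}) :
  weighted_homogeneous w d p -> \sum_i ('X_i * p^`M(i)) *+ w i = p *+ d.
Proof.
move=> hp; rewrite {2}(mpolyE p) -sumrMnl.
under eq_bigr => i _ do
  rewrite [X in X^`M(i)]mpolyE raddf_sum /= mulr_sumr -sumrMnl.
rewrite exchange_big /= big_seq [RHS]big_seq; apply: eq_bigr => m /hp <-.
rewrite /weight -sumrMnr; apply: eq_bigr => i _.
rewrite mderivZ mderivX -!scalerAr scaler_nat mulnC mulrnA; congr (_ *+ _).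
(* X_i * d_i restores X_m, except for m i = 0, where d_i X_m = 0. *)
case: (posnP (m i)) => [->|mi]; first by rewrite !mulr0n scaler0.
by rewrite -mpolyXD addmC submK ?lep1mP -?lt0n // scalerMnr.
Qed.

(** A linear term X_i has weight [w i], so it cannot occur when [w i != d]. *)
Lemma polyfun_mderiv0 (R : realType) n (w : 'I_n -> nat) d (p : {mpoly R[n]}) i :
  weighted_homogeneous w d p -> w i != d -> polyfun p^`M(i) 0 = 0.
Proof.
move=> hp wd; rewrite /polyfun mevalE big_seq big1 // => m.
rewrite mcoeff_msupp mcoeff_mderiv => pm.
have hm : weight w (m + U_(i))%MM = d.
  by apply: hp; rewrite mcoeff_msupp; apply: contraNneq pm => ->; rewrite mul0rn.
have [j mj] : exists j, m j != 0%N.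
  apply/existsP; apply: contraNT wd => /existsPn m0.
  rewrite -hm; suff -> : m = 0%MM by rewrite add0m weightU.
  by apply/mnmP => j; rewrite mnm0E; apply/eqP; move: (m0 j); rewrite negbK.
by rewrite (bigD1 j) //= mxE expr0n (negPf mj) mul0r mulr0.
Qed.

(** * Sums of squares and weights *)

(** Monomials are compared by weight first and by the monomial order next.
    This is a total order compatible with addition, so if q has no monomial
    below e, then e + e splits only as e + e. *)
Lemma mcoeff_sqr_min (R : comNzRingType) n (w : 'I_n -> nat) (q : {mpoly R[n]}) e :
    (forall k, (weight w k < weight w e)%N -> q@_k = 0) ->
    (forall k, weight w k = weight w e -> (k < e)%O -> q@_k = 0) ->
  (q ^+ 2)@_(e + e)%MM = q@_e ^+ 2.
Proof.
move=> lo lex.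
have ltd : (mdeg e < (mdeg (e + e)).+1)%N by rewrite mdegD ltnS leq_addr.
rewrite !expr2 (mcoeff_poly_mul_lin _ _ (ltnSn _)) (bigD1 (BMultinom ltd)) /=; last first.
  exact: lem_addr.
rewrite addmK big1 ?addr0 // => -[k kd] /= /andP[kle].
rewrite -val_eqE /= => ke.
set k' := (e + e - k)%MM.
have kk : (k + k' = e + e)%MM by rewrite addmC submK.
have wk : (weight w k + weight w k' = weight w e + weight w e)%N.
  by rewrite -!weightD kk.
case: (ltngtP (weight w k) (weight w e)) => wke.
- by rewrite lo ?mul0r.
- by rewrite (lo k') ?mulr0 //; lia.
case: (ltgtP k e) => [lke|elk|]; last by move/eqP: ke.
- by rewrite lex ?mul0r.
rewrite (lex k') ?mulr0 //; first by lia.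
rewrite ltNge; apply/negP => lek'.
by have := ltmc_le_add elk lek'; rewrite kk ltxx.
Qed.

(** Well-founded induction on the order of [mcoeff_sqr_min]: once all smaller
    monomials are known to be absent from every q, the coefficient of e + e in
    the sum is the sum of the squares of the coefficients of e, and it vanishes
    since e + e has weight less than 2d. *)
Lemma sos_low_weight (R : realDomainType) n (w : 'I_n -> nat) d
    (s : seq {mpoly R[n]}) :
    weighted_homogeneous w d.*2 (\sum_(q <- s) q ^+ 2) ->
  forall e, (weight w e < d)%N -> {in s, forall q : {mpoly R[n]}, q@_e = 0}.
Proof.
move=> hs e; have [k] := ubnP (weight w e); elim: k e => [|k IHk] //.
elim/(@ltmwf n) => e IHe; rewrite ltnS => wek wed.
have coefE : (\sum_(q <- s) q ^+ 2)@_(e + e)%MM = \sum_(q <- s) q@_e ^+ 2.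
  rewrite raddf_sum /= big_seq [RHS]big_seq; apply: eq_bigr => q qs.
  apply: (@mcoeff_sqr_min _ _ w) => k' wk'.
    by apply: IHk => //; [exact: leq_trans wk' wek | exact: ltn_trans wk' wed].
  by move=> ke; apply: IHe; rewrite // wk' ?ltnS.
have /eqP : \sum_(q <- s) q@_e ^+ 2 = 0.
  rewrite -coefE; apply/eqP; rewrite mcoeff_eq0; apply/negP => /hs.
  by rewrite weightD; lia.
rewrite psumr_eq0 => [/allP z q qs|q _]; last exact: sqr_ge0.
by apply/eqP; rewrite -sqrf_eq0; exact: z.
Qed.

(** When the only way to write m as a sum of two exponents of weight d is m/2
    plus itself, the coefficient of m in each q^2 is a square or 0.  The lower
    bound on the weights suffices: two weights at least d with sum 2d are both
    equal to d. *)
Lemma sos_mcoeff_ge0 (R : realType) n (w : 'I_n -> nat) d (p : {mpoly R[n]}) m :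
    weighted_homogeneous w d.*2 p -> weight w m = d.*2 ->
    (forall e1 e2, (e1 + e2)%MM = m -> weight w e1 = d -> weight w e2 = d ->
       e1 = e2) ->
  sos p -> 0 <= p@_m.
Proof.
move=> hp wm dec [s ps]; rewrite ps in hp *.
rewrite raddf_sum big_seq sumr_ge0 //= => q qs.
have q0 e : (weight w e < d)%N -> q@_e = 0 by move=> we; apply: (sos_low_weight hp).
rewrite expr2 mcoeffM sumr_ge0 // => -[[e1 h1] [e2 h2]] /= /eqP me.
have we : (weight w e1 + weight w e2 = d.*2)%N by rewrite -weightD -me.
case: (ltngtP (weight w e1) d) => w1.
- by rewrite q0 ?mul0r.
- by rewrite (q0 e2) ?mulr0 //; lia.
by rewrite (dec e1 e2) -?expr2 ?sqr_ge0 //; lia.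
Qed.

(** * Gradient flow of a weighted homogeneous function *)

Lemma neg_Vdot_gradient_flow (R : realType) n (V : {mpoly R[n]}) :
  - Vdot V (fun i => - V^`M(i)) = \sum_i V^`M(i) ^+ 2.
Proof. by rewrite -sumrN; apply: eq_bigr => i _; rewrite mulrN opprK. Qed.

(** By Euler's identity, V vanishes wherever its gradient does. *)
Lemma neg_Vdot_gradient_flow_pd (R : realType) n (w : 'I_n -> nat) d (V : {mpoly R[n]}) :
    weighted_homogeneous w d V -> (0 < d)%N -> positive_definite (polyfun V) ->
  positive_definite (polyfun (- Vdot V (fun i => - V^`M(i)))).
Proof.
move=> hV d0 pV x x0.
have -> : polyfun (- Vdot V (fun i => - V^`M(i))) x
          = \sum_i (polyfun V^`M(i) x) ^+ 2.
  rewrite neg_Vdot_gradient_flow /polyfun raddf_sum; apply: eq_bigr => i _.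
  exact: rmorphXn.
rewrite lt0r sumr_ge0 ?andbT => [|i _]; last exact: sqr_ge0.
rewrite psumr_eq0 => [|i _]; last exact: sqr_ge0.
apply/negP => /allP z; have := pV x x0.
suff -> : polyfun V x = 0 by rewrite ltxx.
have := congr1 (fun p => polyfun p x) (weighted_euler hV).
rewrite /polyfun mevalMn raddf_sum /= big1 => [/esym/eqP|i _].
  by rewrite mulrn_eq0 eqn0Ngt d0 => /eqP.
move: (z i (mem_index_enum _)); rewrite /= sqrf_eq0 => /eqP zi.
by rewrite mevalMn mevalM [X in _ * X]zi mulr0 mul0rn.
Qed.

(** * The example *)

Definition example_weights (i : 'I_4) : nat := nth 0 [:: 15; 10; 6; 1]%N i.
Definition mnm4 (a b c d : nat) : 'X_{1..4} := [multinom [tuple a; b; c; d]].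

Definition V_example (R : realType) : {mpoly R[4]} :=
  'X_[mnm4 4 0 0 0] + 'X_[mnm4 0 6 0 0] + 'X_[mnm4 0 0 10 0] + 'X_[mnm4 0 0 0 60]
  - 'X_[mnm4 1 2 4 1].

Lemma mnm4E a b c d i : mnm4 a b c d i = nth 0%N [:: a; b; c; d] i.
Proof. by rewrite multinomE (tnth_nth 0%N). Qed.

Lemma weight_example m : weight example_weights m =
  (15 * m 0%R + 10 * m 1%R + 6 * m 2%R + m 3%R)%N.
Proof.
rewrite /weight !big_ord_recr big_ord0 Monoid.mul1m -[m 3%R]mul1n.
by congr (_ * m _ + _ * m _ + _ * m _ + _ * m _)%N; apply/val_inj.
Qed.

Lemma V_example_homogeneous (R : realType) :
  weighted_homogeneous example_weights 60 (V_example R).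
Proof.
move=> m /msuppB_le; rewrite mem_cat => /orP[|/mem_msuppXP <-]; last first.
  by rewrite weight_example !mnm4E.
do 3! (move=> /msuppD_le; rewrite mem_cat => /orP[|/mem_msuppXP <-]; last first;
  first by rewrite weight_example !mnm4E).
by move=> /mem_msuppXP <-; rewrite weight_example !mnm4E.
Qed.

(** If x divides the first factor, say, then the rest of its weight is 15,
    which is odd, so it must contain t; the remaining 14 is not a sum of some of
    10, 10, 6, 6, 6, 6. *)
Lemma mixed_exponent_undecomposable (e1 e2 : 'X_{1..4}) :
  (e1 + e2)%MM = mnm4 1 2 4 1 -> weight example_weights e1 = 30 ->
  weight example_weights e2 != 30.
Proof.
move=> /mnmP e12; rewrite !weight_example.
move: (e12 0%R) (e12 1%R) (e12 2%R) (e12 3%R); rewrite !mnmDE !mnm4E /=.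
by lia.
Qed.

Lemma V_example_not_sos (R : realType) : ~ sos (V_example R).
Proof.
have wm : weight example_weights (mnm4 1 2 4 1) = 60 by rewrite weight_example !mnm4E.
move=> sosV.
have: 0 <= (V_example R)@_(mnm4 1 2 4 1).
  apply: (sos_mcoeff_ge0 (@V_example_homogeneous R) (d := 30) wm _ sosV) => e1 e2 h w1 w2.
  by have := mixed_exponent_undecomposable h w1; rewrite w2.
by rewrite /V_example !(mcoeffB, mcoeffD, mcoeffX) /= !add0r oppr_ge0 ler10.
Qed.

Lemma meval_mnm4 (R : realType) (v : 'I_4 -> R) a b c d :
  'X_[mnm4 a b c d].@[v] = v 0 ^+ a * v 1 ^+ b * v 2 ^+ c * v 3 ^+ d.
Proof.
rewrite mevalX !big_ord_recr big_ord0 !mnm4E Monoid.mul1m.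
by congr (v _ ^+ _ * v _ ^+ _ * v _ ^+ _ * v _ ^+ _); apply/val_inj.
Qed.

(** Weighted arithmetic-geometric mean with weights 15/60, 20/60, 24/60, 1/60:
    if T > 0, all four pure powers are positive, so each is less than their
    sum M, and T^60 < M^15 M^20 M^24 M. *)
Lemma mixed_lt_pure_powers (R : realDomainType) (x y z t : R) :
  [|| x != 0, y != 0, z != 0 | t != 0] ->
  0 < x ^+ 4 + y ^+ 6 + z ^+ 10 + t ^+ 60 - x * y ^+ 2 * z ^+ 4 * t.
Proof.
have ev n (a : R) : 0 <= a ^+ n.*2 by rewrite -mul2n exprM exprn_ge0 ?sqr_ge0.
have evp n (a : R) : a != 0 -> 0 < a ^+ n.*2 by move=> a0; rewrite lt0r expf_neq0 ?ev.
have x4 : 0 <= x ^+ 4 := ev 2 x.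
have y6 : 0 <= y ^+ 6 := ev 3 y.
have z10 : 0 <= z ^+ 10 := ev 5 z.
have t60 : 0 <= t ^+ 60 := ev 30 t.
move=> nz; rewrite subr_gt0.
set T := _ * t; set M := (_ + t ^+ 60).
have M0 : 0 < M.
  have -> : M = x ^+ 4 + (y ^+ 6 + (z ^+ 10 + t ^+ 60)) by rewrite !addrA.
  case/or4P: nz => nz.
  - by rewrite ltr_wpDr ?addr_ge0 ?(evp 2 x).
  - by rewrite ltr_wpDl // ltr_wpDr ?addr_ge0 ?(evp 3 y).
  - by rewrite ltr_wpDl // ltr_wpDl // ltr_wpDr ?(evp 5 z).
  - by rewrite !ltr_wpDl ?(evp 30 t).
have [T0|T0] := leP T 0; first exact: le_lt_trans T0 M0.
rewrite -(@ltr_pXn2r _ 60) ?nnegrE ?ltW //.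
have x0 : x != 0 by apply: contraTneq T0 => x0; rewrite /T x0 !mul0r ltxx.
have y0 : y != 0 by apply: contraTneq T0 => y0; rewrite /T y0 expr0n mulr0 !mul0r ltxx.
have z0 : z != 0 by apply: contraTneq T0 => z0; rewrite /T z0 expr0n mulr0 !mul0r ltxx.
have t0 : t != 0 by apply: contraTneq T0 => t0; rewrite /T t0 mulr0 ltxx.
have {}x4 : 0 < x ^+ 4 := evp 2 x x0.
have {}y6 : 0 < y ^+ 6 := evp 3 y y0.
have {}z10 : 0 < z ^+ 10 := evp 5 z z0.
have {}t60 : 0 < t ^+ 60 := evp 30 t t0.
have -> : T ^+ 60 = (x ^+ 4) ^+ 15 * (y ^+ 6) ^+ 20 * (z ^+ 10) ^+ 24 * t ^+ 60.
  by rewrite -!exprM /T 3!exprMn -!exprM.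
have -> : M ^+ 60 = M ^+ 15 * M ^+ 20 * M ^+ 24 * M by rewrite -!exprD -exprSr.
move: x4 y6 z10 t60; rewrite {M0 nz x0 y0 z0 t0 T0 T}/M.
move: (x ^+ 4) (y ^+ 6) (z ^+ 10) (t ^+ 60) => a b c d a0 b0 c0 d0.
have pX e m (h : 0 < e) : 0 <= e ^+ m :> R by rewrite exprn_ge0 ?ltW.
have lX e m (h : 0 < e) : e < a + b + c + d -> (0 < m)%N -> e ^+ m < (a + b + c + d) ^+ m.
  by move=> eM m0; rewrite ltrXn2r -?lt0n ?eM // ltW.
by rewrite !ltr_pM ?mulr_ge0 ?pX ?lX ?ltW //; lra.
Qed.

Lemma V_example_pd (R : realType) : positive_definite (polyfun (V_example R)).
Proof.
move=> v v0; rewrite /polyfun /V_example !(mevalB, mevalD) !meval_mnm4.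
rewrite !expr0 !expr1 !mulr1 !mul1r; apply: mixed_lt_pure_powers.
apply: contraNT v0; rewrite !negb_or !negbK => /and4P[/eqP v0 /eqP v1 /eqP v2 /eqP v3].
apply/eqP/rowP => i; rewrite mxE.
by case: i => [[|[|[|[|//]]]] h];
  [rewrite -v0 | rewrite -v1 | rewrite -v2 | rewrite -v3]; congr (v _ _); apply/val_inj.
Qed.

Theorem lemma3p12 (R : realType) :
  exists (n : nat) (f : polynomial_vector_field R n) (V : {mpoly R[n]}),
    [/\ (0 < n)%N,
        vanishes_at_origin f,
        positive_definite (polyfun V),
        positive_definite (polyfun (- Vdot V f))
      & sos (- Vdot V f) /\ ~ sos V].
Proof.
exists 4, (fun i => - (V_example R)^`M(i)), (V_example R); split=> //.
- move=> i; have wi : example_weights i != 60 by case: i => [[|[|[|[|//]]]] h].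
  have := polyfun_mderiv0 (@V_example_homogeneous R) wi.
  by rewrite /polyfun mevalN => ->; rewrite oppr0.
- exact: V_example_pd.
- exact: neg_Vdot_gradient_flow_pd (@V_example_homogeneous R) _ (@V_example_pd R).
split; last exact: V_example_not_sos.
exists [seq (V_example R)^`M(i) | i <- index_enum 'I_4].
by rewrite big_map neg_Vdot_gradient_flow.
Qed.
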